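(* Let $\omega$ be a valuation transcendental extension of $\nu$ to $K(x)$ and let $(a,\gamma)$ be a pair of definition for $\omega$. Assume that $(K,\nu)$ is henselian and $(K(a)|K,\overline{\nu})$ is a defectless extension. Take a complete distinguished chain $a=a_0,a_1,\dotsc,a_n$ of $a$. Then $(a_i,\gamma)$ is a minimal pair of definition for $\omega$ for some $i\in\{0,\dotsc,n\}$.
   Context: $(K,\nu)$ is a valued field (values written additively, $\nu 0=\infty$), $\overline{K}$ a fixed algebraic closure of $K$, and $K(x)$ the rational function field. For a valued field $(L,\nu)$, $\nu L$ and $L\nu$ denote the value group and residue field. An extension $\omega$ of $\nu$ to $K(x)$ is value transcendental if $\dim_{\mathbb{Q}}\big((\omega K(x)/\nu K)\otimes_{\mathbb{Z}}\mathbb{Q}\big)=1$, residue transcendental if $\mathrm{trdeg}[K(x)\omega:K\nu]=1$, and valuation transcendental if it is one of these. Fix an extension $\overline{\nu}$ of $\nu$ to $\overline{K}$ and a common extension $\overline{\omega}$ of $\omega$ and $\overline{\nu}$ to $\overline{K}(x)$. For $a\in\overline{K}$ and $\gamma$ in an ordered abelian group containing $\overline{\nu}\,\overline{K}$, $\overline{\nu}_{a,\gamma}$ is the valuation on $\overline{K}(x)$ determined by $\overline{\nu}_{a,\gamma}\big(\sum_i c_i(x-a)^i\big)=\min_i\{\overline{\nu}c_i+i\gamma\}$ ($c_i\in\overline{K}$). A pair $(a,\gamma)$ with $a\in\overline{K}$, $\gamma\in\overline{\omega}\,\overline{K}(x)$ is a pair of definition for $\omega$ if $\overline{\omega}=\overline{\nu}_{a,\gamma}$;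 it is a minimal pair of definition if moreover for every $b\in\overline{K}$, $\overline{\nu}(a-b)\geq\gamma$ implies $[K(a):K]\leq[K(b):K]$. A finite extension $(L|K,\overline{\nu})$ is defectless if $[L:K]=(\overline{\nu}L:\nu K)[L\overline{\nu}:K\nu]$. For $a\in\overline{K}$ put $M(a):=\{\overline{\nu}(a-z)\mid z\in\overline{K},\ [K(z):K]<[K(a):K]\}$ and let $\delta(a,K)$ denote $\max M(a)$ whenever it exists. A pair $(a,z)\in\overline{K}\times\overline{K}$ is a distinguished pair if $[K(z):K]<[K(a):K]$, $\overline{\nu}(a-z)=\delta(a,K)$, and $[K(z):K]$ is minimal with respect to this property. A chain $a=a_0,a_1,\dotsc,a_n$ of elements of $\overline{K}$ is a complete distinguished chain of $a$ if $(a_i,a_{i+1})$ is a distinguished pair for each $i=0,\dotsc,n-1$ and $a_n\in K$. *)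

(* Defs.v *)
From HB Require Import structures.
From mathcomp Require Import all_boot all_order all_algebra.
From mathcomp Require Import boolp classical_sets cardinality.
From mathcomp Require mpoly.

Set Implicit Arguments.
Unset Strict Implicit.
Unset Printing Implicit Defensive.

Import Order.TTheory GRing.Theory Num.Theory.
Local Open Scope ring_scope.

(* The order is a relation of its own: joining mathcomp's [orderType] and
   [zmodType] here would create a structure below [realDomainType]. *)
HB.mixin Record isOrderedZmodule G of GRing.Zmodule G := {
  gle : rel G;
  gle_anti : antisymmetric gle;
  gle_trans : transitive gle;
  gle_total : total gle;
  gle_addr : forall z x y : G, gle x y -> gle (x + z) (y + z)
}.

#[short(type="orderedZmodType")]
HB.structure Definition OrderedZmodule :=
  { G of isOrderedZmodule G & GRing.Zmodule G }.

Section Values.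
Variable G : orderedZmodType.
Implicit Types s t : option G.

Lemma gle_refl (x : G) : gle x x.
Proof. by case/orP: (gle_total x x). Qed.

(* [None] is the value infinity. *)
Definition vle s t : bool :=
  match s, t with
  | _, None => true
  | None, Some _ => false
  | Some x, Some y => gle x y
  end.

Definition vlt s t : bool := ~~ vle t s.

Definition vmin s t := if vle s t then s else t.

Definition vadd s t : option G :=
  if (s, t) is (Some x, Some y) then Some (x + y) else None.

(* Only meaningful for [t] finite. *)
Definition vsub s t : option G :=
  if (s, t) is (Some x, Some y) then Some (x - y) else None.

End Values.

Record valuation (F : fieldType) (G : orderedZmodType) := Valuation {
  vval :> F -> option G;
  vval_eq0 : forall x, (vval x == None) = (x == 0);
  vvalM : forall x y, vval (x * y) = vadd (vval x) (vval y);
  vvalD : forall x y, vle (vmin (vval x) (vval y)) (vval (x + y))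
}.

Section ValuationTheory.
Variables (F : fieldType) (G : orderedZmodType) (v : valuation F G).

Lemma vval0 : v 0 = None.
Proof. by apply/eqP; rewrite vval_eq0. Qed.

Lemma vval_fin x : x != 0 -> exists g, v x = Some g.
Proof. by rewrite -(vval_eq0 v); case: (v x) => // g _; exists g. Qed.

Lemma ge0_double (g : G) : g + g = 0 -> g = 0.
Proof.
move=> gg; case/orP: (gle_total 0 g) => h; have := gle_addr g _ _ h;
  rewrite gg add0r => h'; apply: gle_anti; rewrite h h' //.
Qed.

Lemma vval1 : v 1 = Some 0.
Proof.
have [g eg] := vval_fin (oner_neq0 F).
have := vvalM v 1 1; rewrite mulr1 eg => -[] /eqP.
by rewrite -subr_eq0 opprD addrA subrr sub0r oppr_eq0 => /eqP ->.
Qed.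

Lemma vvalN x : v (- x) = v x.
Proof.
have [->|x0] := eqVneq x 0; first by rewrite oppr0.
have [g eg] : exists g, v (-1) = Some g by apply: vval_fin; rewrite oppr_eq0 oner_eq0.
have : v (-1) = Some 0.
  have := vvalM v (-1) (-1); rewrite mulrNN mulr1 vval1 eg => -[] /esym.
  by move/ge0_double ->.
move=> e; rewrite -mulN1r vvalM e; case: (v x) => //= h.
by rewrite /vadd add0r.
Qed.

Lemma vvalV x g : v x = Some g -> v x^-1 = Some (- g).
Proof.
move=> eg; have x0 : x != 0 by rewrite -(vval_eq0 v) eg.
have [h eh] : exists h, v x^-1 = Some h by apply: vval_fin; rewrite invr_eq0.
have := vvalM v x x^-1; rewrite divff // vval1 eg eh => -[] /esym/eqP.
by rewrite addrC addr_eq0 => /eqP ->.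
Qed.

Lemma vle_trans : transitive (@vle G).
Proof. by move=> [y|] [x|] [z|] //=; apply: gle_trans. Qed.

Lemma vle_min s t (u : option G) : vle s t -> vle s u -> vle s (vmin t u).
Proof. by rewrite /vmin; case: ifP. Qed.

Lemma vlt_min s t (u : option G) : vlt s t -> vlt s u -> vlt s (vmin t u).
Proof. by rewrite /vmin; case: ifP. Qed.

Lemma vlt_le_trans (s t u : option G) : vlt s t -> vle t u -> vlt s u.
Proof. by rewrite /vlt => h tu; apply: contra h => /(vle_trans tu). Qed.

Definition in_value_group : {pred G} :=
  [pred g | `[< exists2 x, x != 0 & v x = Some g >]].

Lemma in_value_group_zmod_closed : zmod_closed in_value_group.
Proof.
split; first by apply/asboolP; exists 1; rewrite ?oner_eq0 ?vval1.
move=> g h /asboolP[x x0 xg] /asboolP[y y0 yh]; apply/asboolP.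
exists (x / y); first by rewrite mulf_neq0 ?invr_eq0.
by rewrite vvalM xg (vvalV yh).
Qed.
HB.instance Definition _ :=
  GRing.isZmodClosed.Build G in_value_group in_value_group_zmod_closed.

Record value_group := ValueGroup {
  value_of :> G; _ : value_of \in in_value_group }.
HB.instance Definition _ := [isSub for value_of].
HB.instance Definition _ := [Choice of value_group by <:].
HB.instance Definition _ := [SubChoice_isSubZmodule of value_group by <:].

Definition in_val_ring : {pred F} := [pred x | vle (Some 0) (v x)].

Lemma in_val_ring_closed : subring_closed in_val_ring.
Proof.
split; first by rewrite inE vval1 /= gle_refl.
  move=> x y; rewrite !inE => hx hy.
  by apply: vle_trans (vvalD v x (- y)); rewrite vvalN; apply: vle_min.
move=> x y; rewrite !inE vvalM; case: (v x) (v y) => [g|] [h|] //= g0 h0.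
by apply: gle_trans h0 _; have := gle_addr h _ _ g0; rewrite add0r.
Qed.
HB.instance Definition _ :=
  GRing.isSubringClosed.Build F in_val_ring in_val_ring_closed.

Record val_ring := ValRing { val_ring_val :> F; _ : val_ring_val \in in_val_ring }.
HB.instance Definition _ := [isSub for val_ring_val].
HB.instance Definition _ := [Choice of val_ring by <:].
HB.instance Definition _ := [SubChoice_isSubComNzRing of val_ring by <:].

Definition val_ideal : {pred val_ring} :=
  [pred x : val_ring | vlt (Some 0) (v (val x))].

Lemma val_ideal_closed : idealr_closed val_ideal.
Proof.
split; first by rewrite inE rmorph0 vval0.
  by rewrite inE rmorph1 vval1 /vlt /= gle_refl.
move=> a x y; rewrite !inE rmorphD rmorphM /= => hx hy.
apply: vlt_le_trans (vvalD v _ _); apply: vlt_min => //.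
rewrite vvalM; have := valP a; rewrite inE /=.
move: hx; rewrite /vlt; case: (v (val x)) (v (val a)) => [g|] [h|] //=.
move=> g0 h0; apply: contra g0; apply: gle_trans.
by have := gle_addr g _ _ h0; rewrite add0r addrC.
Qed.
HB.instance Definition _ := isIdealr.Build val_ring val_ideal val_ideal_closed.

Definition residue_field : Type := {ideal_quot val_ideal}.
HB.instance Definition _ := GRing.ComNzRing.on residue_field.
HB.instance Definition _ := EqQuotient.on residue_field.

Definition residue (x : val_ring) : residue_field := \pi_residue_field%qT x.

Lemma residue_is_zmod_morphism : zmod_morphism residue.
Proof. exact: (rmorphB (\pi_{ideal_quot val_ideal}%qT)). Qed.
HB.instance Definition _ :=
  GRing.isZmodMorphism.Build val_ring residue_field residue
    residue_is_zmod_morphism.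

Lemma residue_is_monoid_morphism : monoid_morphism residue.
Proof.
by split; [exact: (rmorph1 (\pi_{ideal_quot val_ideal}%qT))
          |exact: (rmorphM (\pi_{ideal_quot val_ideal}%qT))].
Qed.
HB.instance Definition _ :=
  GRing.isMonoidMorphism.Build val_ring residue_field residue
    residue_is_monoid_morphism.

Lemma residue_repr (x : residue_field) : residue (repr x) = x.
Proof. exact: reprK. Qed.

Lemma residue_eq (x y : val_ring) :
  (residue x == residue y) = (x - y \in val_ideal).
Proof. by rewrite (Quotient.idealrBE val_ideal). Qed.

Lemma residue_eq0 (x : val_ring) :
  (residue x == 0) = vlt (Some 0) (v (val x)).
Proof. by rewrite -(rmorph0 residue) residue_eq subr0. Qed.

Definition residue_inv (x : residue_field) : residue_field :=
  if insub (val (repr x))^-1 is Some y then residue y else 0.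

Lemma residue_mulV (x : residue_field) : x != 0 -> residue_inv x * x = 1.
Proof.
rewrite -{1 3}(residue_repr x) residue_eq0 /residue_inv.
move: (repr x) => a a0; have : v (val a) = Some 0.
  have := valP a; move: a0; rewrite inE /=; case: (v (val a)) => // g.
  by rewrite /vlt negbK /= => h1 h2; congr Some; apply: gle_anti; rewrite h1 h2.
move=> va; have vi := vvalV va; rewrite oppr0 in vi.
case: insubP => [u _ hu|]; last by rewrite inE vi /= gle_refl.
rewrite -rmorphM -[RHS](rmorph1 residue); congr residue; apply: val_inj.
by rewrite [LHS](_ : _ = val u * val a) // hu mulVf // -(vval_eq0 v) va.
Qed.

Lemma residue_inv0 : residue_inv 0 = 0.
Proof.
rewrite /residue_inv; have := eqxx (0 : residue_field).
rewrite -{1}(residue_repr 0) residue_eq0; move: (repr 0) => a a0.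
case: insubP => // u; rewrite inE => hu eu; apply/eqP; rewrite residue_eq0 eu.
case va: (v (val a)) => [g|]; last first.
  by move/eqP: va; rewrite vval_eq0 => /eqP ->; rewrite invr0 vval0.
case/negP: a0; move: hu; rewrite (vvalV va) va /= => g0.
by have := gle_addr g _ _ g0; rewrite add0r addNr.
Qed.

HB.instance Definition _ :=
  GRing.ComNzRing_isField.Build residue_field residue_mulV residue_inv0.

End ValuationTheory.

Arguments in_val_ring {F G} v.
Arguments in_value_group {F G} v.
Arguments residue_field {F G} v.
Arguments value_group {F G} v.

Section Pullback.
Variables (F E : fieldType) (G : orderedZmodType).
Variables (f : {rmorphism F -> E}) (w : valuation E G).

Let pb_eq0 x : (w (f x) == None) = (x == 0).
Proof. by rewrite vval_eq0 fmorph_eq0. Qed.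
Let pbM x y : w (f (x * y)) = vadd (w (f x)) (w (f y)).
Proof. by rewrite rmorphM vvalM. Qed.
Let pbD x y : vle (vmin (w (f x)) (w (f y))) (w (f (x + y))).
Proof. by rewrite rmorphD vvalD. Qed.

(* Restriction of [w] to the subfield [f : F -> E]. *)
Definition restrict_val : valuation F G := Valuation pb_eq0 pbM pbD.

End Pullback.

(* [Vector.axiom] of mathcomp, as a proposition. *)
Definition has_dim (F : fieldType) (V : lmodType F) (n : nat) : Prop :=
  exists2 phi : V -> 'rV[F]_n, linear phi & bijective phi.

Section FieldExtension.
Variables (F E : fieldType) (f : {rmorphism F -> E}).

(* [E] as a vector space over [F]. *)
Definition ext_space : Type := (fun _ : {rmorphism F -> E} => E : Type) f.
HB.instance Definition _ := GRing.Zmodule.copy ext_space E.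

Definition ext_scale (c : F) (x : ext_space) : ext_space := f c * (x : E).

Lemma ext_scaleA a b x : ext_scale a (ext_scale b x) = ext_scale (a * b) x.
Proof. by rewrite /ext_scale mulrA rmorphM. Qed.
Lemma ext_scale1 : left_id 1 ext_scale.
Proof. by move=> x; rewrite /ext_scale rmorph1 mul1r. Qed.
Lemma ext_scaleDr : right_distributive ext_scale +%R.
Proof. by move=> c x y; exact: mulrDr. Qed.
Lemma ext_scaleDl x : {morph ext_scale^~ x : a b / a + b}.
Proof. by move=> a b; rewrite /ext_scale rmorphD; exact: mulrDl. Qed.
HB.instance Definition _ :=
  GRing.Zmodule_isLmodule.Build F ext_space
    ext_scaleA ext_scale1 ext_scaleDr ext_scaleDl.

Definition has_degree (n : nat) : Prop := has_dim ext_space n.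

(* 0 if the extension is infinite. *)
Definition degree : nat := xget 0%N [set n | has_degree n]%classic.

Variable S : set E.

(* The subfield F(S) of E generated by f(F) and S. *)
Definition in_adjoin : {pred E} := [pred z | `[<
  forall P : {pred E}, divring_closed P ->
    (forall c, f c \in P) -> (forall s, S s -> s \in P) -> z \in P >]].

Lemma in_adjoin_closed : divring_closed in_adjoin.
Proof.
split=> [|x y /asboolP hx /asboolP hy|x y /asboolP hx /asboolP hy];
  apply/asboolP => P clP Pf PS; have [P1 PB PV] := clP; first exact: P1.
- exact: PB (hx P clP Pf PS) (hy P clP Pf PS).
- exact: PV (hx P clP Pf PS) (hy P clP Pf PS).
Qed.
HB.instance Definition _ :=
  GRing.isDivringClosed.Build E in_adjoin in_adjoin_closed.

Record adjoin := Adjoin { adjoin_val :> E; _ : adjoin_val \in in_adjoin }.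
HB.instance Definition _ := [isSub for adjoin_val].
HB.instance Definition _ := [Choice of adjoin by <:].
HB.instance Definition _ := [SubChoice_isSubIntegralDomain of adjoin by <:].
HB.instance Definition _ := [SubIntegralDomain_isSubField of adjoin by <:].

Lemma in_adjoin_base c : f c \in in_adjoin.
Proof. by apply/asboolP => P _ Pf _; apply: Pf. Qed.

Definition to_adjoin (c : F) : adjoin := Adjoin (in_adjoin_base c).

Lemma to_adjoin_is_zmod_morphism : zmod_morphism to_adjoin.
Proof. by move=> x y; apply: val_inj; rewrite [LHS]/= rmorphB. Qed.
HB.instance Definition _ :=
  GRing.isZmodMorphism.Build F adjoin to_adjoin to_adjoin_is_zmod_morphism.

Lemma to_adjoin_is_monoid_morphism : monoid_morphism to_adjoin.
Proof.
by split=> [|x y]; apply: val_inj; rewrite [LHS]/= (rmorph1, rmorphM).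
Qed.
HB.instance Definition _ :=
  GRing.isMonoidMorphism.Build F adjoin to_adjoin to_adjoin_is_monoid_morphism.

End FieldExtension.

(* [E] over [F] has a transcendence basis of [n] elements. *)
Definition has_trdeg (F E : fieldType) (f : {rmorphism F -> E}) (n : nat) :=
  exists2 t : 'I_n -> E,
    injective (@mpoly.mmap n F E f t) &
    forall y : E,
      algebraicOver (val : adjoin f [set t i | i in setT]%classic -> E) y.

Section ValuedExtension.
Variables (F E : fieldType) (G : orderedZmodType) (f : {rmorphism F -> E}).
Variables (v : valuation F G) (w : valuation E G).

Definition extends : Prop := forall c, w (f c) = v c.

(* vF as a subgroup of wE; it is only used when [extends] holds. *)
Definition in_base_group : {pred value_group w} :=
  [pred g : value_group w | val g \in in_value_group v].

Lemma in_base_group_closed : zmod_closed in_base_group.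
Proof.
have baseE g : (g \in in_base_group) = (val g \in in_value_group v) by [].
split=> [|g h]; rewrite !baseE ?raddf0 ?raddfB ?rpred0 //; exact: rpredB.
Qed.
HB.instance Definition _ :=
  GRing.isZmodClosed.Build (value_group w) in_base_group in_base_group_closed.

(* wE / vF *)
Definition value_quotient : Type := Quotient.quot in_base_group.
HB.instance Definition _ := GRing.Zmodule.on value_quotient.

(* (wE : vF) = e *)
Definition has_ramification_index (e : nat) : Prop :=
  ([set: value_quotient] #= `I_e)%card.

Hypothesis wf : extends.

Lemma in_val_ring_ext (x : val_ring v) : f (val x) \in in_val_ring w.
Proof. by have := valP x; rewrite !inE wf. Qed.

Definition val_ring_map (x : val_ring v) : val_ring w :=
  ValRing (in_val_ring_ext x).

Definition residue_map (x : residue_field v) : residue_field w :=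
  residue (val_ring_map (repr x)).

Lemma residue_mapE (x : val_ring v) :
  residue_map (residue x) = residue (val_ring_map x).
Proof.
apply/eqP; rewrite residue_eq inE /= -rmorphB wf.
by have /eqP := residue_repr (residue x); rewrite residue_eq.
Qed.

Lemma residue_map_is_zmod_morphism : zmod_morphism residue_map.
Proof.
move=> x y; rewrite -(residue_repr x) -(residue_repr y) -rmorphB !residue_mapE.
by rewrite -rmorphB; congr residue; apply: val_inj; rewrite [LHS]/= rmorphB.
Qed.
HB.instance Definition _ :=
  GRing.isZmodMorphism.Build (residue_field v) (residue_field w) residue_map
    residue_map_is_zmod_morphism.

Lemma residue_map_is_monoid_morphism : monoid_morphism residue_map.
Proof.
split.
  rewrite -(rmorph1 (@residue _ _ v)) residue_mapE -(rmorph1 (@residue _ _ w)).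
  by congr residue; apply: val_inj; rewrite [LHS]/= rmorph1.
move=> x y; rewrite -(residue_repr x) -(residue_repr y) -rmorphM !residue_mapE.
by rewrite -rmorphM; congr residue; apply: val_inj; rewrite [LHS]/= rmorphM.
Qed.
HB.instance Definition _ :=
  GRing.isMonoidMorphism.Build (residue_field v) (residue_field w) residue_map
    residue_map_is_monoid_morphism.

(* Includes the finiteness of the extension. *)
Definition defectless : Prop :=
  exists n e d : nat, [/\ has_degree f n, has_ramification_index e,
    has_degree residue_map d & n = (e * d)%N].

End ValuedExtension.

(* [iota : F -> L] embeds [F] in the algebraically closed field [L], which is
   an algebraic closure of [F] when all its elements are algebraic over [F].
   Uniqueness of extensions to [L] is up to equivalence, i.e. it is expressed
   by means of valuation rings. *)
Definition henselian (F : fieldType) (L : closedFieldType)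
    (iota : {rmorphism F -> L}) (G : orderedZmodType) (v : valuation F G) :=
  forall (G1 G2 : orderedZmodType)
    (w1 : valuation L G1) (w2 : valuation L G2),
    in_val_ring (restrict_val iota w1) =i in_val_ring v ->
    in_val_ring (restrict_val iota w2) =i in_val_ring v ->
    in_val_ring w1 =i in_val_ring w2.

Notation ratfun F := {fraction {poly F}}.
Notation "p %:F" := (FracField.tofrac p) : ring_scope.

Section RationalFunctions.
Variable F : fieldType.

Definition ratfun_const (c : F) : ratfun F := (c%:P)%:F.
HB.instance Definition _ :=
  GRing.RMorphism.copy ratfun_const (@FracField.tofrac {poly F} \o polyC).

Definition ratfun_num (r : ratfun F) : {poly F} := (frac (repr r)).1.
Definition ratfun_den (r : ratfun F) : {poly F} := (frac (repr r)).2.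

Lemma ratfun_den_neq0 r : ratfun_den r != 0.
Proof. exact: denom_ratioP. Qed.

Lemma ratfunE r : r = (ratfun_num r)%:F / (ratfun_den r)%:F.
Proof.
have d0 := ratfun_den_neq0 r; rewrite -[LHS]reprK; unlock FracField.tofrac.
rewrite -[X in _ = _ * X]FracField.pi_inv -[RHS]FracField.pi_mul.
rewrite /FracField.mulf /FracField.invf !numden_Ratio ?oner_eq0 //.
by rewrite mulr1 mul1r Ratio_numden.
Qed.

End RationalFunctions.

Section RatfunMap.
Variables (F E : fieldType) (f : {rmorphism F -> E}).

Definition ratfun_map (r : ratfun F) : ratfun E :=
  (map_poly f (ratfun_num r))%:F / (map_poly f (ratfun_den r))%:F.

Lemma ratfun_mapE p q :
  q != 0 -> ratfun_map (p%:F / q%:F) = (map_poly f p)%:F / (map_poly f q)%:F.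
Proof.
move=> q0; have d0 := ratfun_den_neq0 (p%:F / q%:F).
apply/eqP; rewrite eqr_div ?tofrac_eq0 ?map_poly_eq0 //.
rewrite -!rmorphM; apply/eqP; do 2 congr (_ _); apply/eqP.
by rewrite -tofrac_eq !rmorphM /= -eqr_div ?tofrac_eq0 // -ratfunE.
Qed.

Lemma ratfun_map_is_zmod_morphism : zmod_morphism ratfun_map.
Proof.
move=> r s; rewrite {1}(ratfunE r) {1}(ratfunE s) -mulNr -rmorphN.
have [rd sd] := (ratfun_den_neq0 r, ratfun_den_neq0 s).
rewrite addf_div ?tofrac_eq0 // -!rmorphM -rmorphD ratfun_mapE ?mulf_neq0 //.
rewrite /ratfun_map -mulNr -rmorphN addf_div ?tofrac_eq0 ?map_poly_eq0 //.
by rewrite !(rmorphM, rmorphD, rmorphN).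
Qed.
HB.instance Definition _ :=
  GRing.isZmodMorphism.Build (ratfun F) (ratfun E) ratfun_map
    ratfun_map_is_zmod_morphism.

Lemma ratfun_map_is_monoid_morphism : monoid_morphism ratfun_map.
Proof.
split=> [|r s].
  by rewrite -[1](divr1 1) -(rmorph1 (@FracField.tofrac {poly F}))
    ratfun_mapE ?oner_eq0 // rmorph1 rmorph1 divr1.
rewrite {1}(ratfunE r) {1}(ratfunE s) mulf_div -!rmorphM.
rewrite ratfun_mapE ?mulf_neq0 ?ratfun_den_neq0 //.
by rewrite /ratfun_map mulf_div !rmorphM.
Qed.
HB.instance Definition _ :=
  GRing.isMonoidMorphism.Build (ratfun F) (ratfun E) ratfun_map
    ratfun_map_is_monoid_morphism.

End RatfunMap.

(* [phi] exhibits [V] as the tensor product of [A] and the rationals over the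
   integers, via the universal property of extension of scalars. *)
Definition is_rationalization (A : zmodType) (V : lmodType rat)
    (phi : {additive A -> V}) : Prop :=
  forall (W : lmodType rat) (g : {additive A -> W}),
    exists2 h : {linear V -> W}, h \o phi =1 g &
      forall h' : {linear V -> W}, h' \o phi =1 g -> h' =1 h.

Definition has_rational_rank (A : zmodType) (n : nat) : Prop :=
  exists (V : lmodType rat) (phi : {additive A -> V}),
    is_rationalization phi /\ has_dim V n.

Section Transcendental.
Variables (K : fieldType) (G : orderedZmodType).
Variables (nu : valuation K G) (omega : valuation (ratfun K) G).

Definition value_transcendental : Prop :=
  has_rational_rank (value_quotient nu omega) 1.

Definition residue_transcendental
    (ext : extends (@ratfun_const K) nu omega) : Prop :=
  has_trdeg (residue_map ext) 1.

Definition valuation_transcendental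
    (ext : extends (@ratfun_const K) nu omega) : Prop :=
  value_transcendental \/ residue_transcendental ext.

End Transcendental.

Section AdjoinExtension.
Variables (K E : fieldType) (iota : {rmorphism K -> E}) (S : set E).
Variables (G : orderedZmodType) (nu : valuation K G) (nubar : valuation E G).

Definition adjoin_valuation : valuation (adjoin iota S) G :=
  restrict_val (val : adjoin iota S -> E) nubar.

Lemma extends_adjoin :
  extends iota nu nubar -> extends (to_adjoin iota S) nu adjoin_valuation.
Proof. by []. Qed.

End AdjoinExtension.

Definition elt_defectless (K E : fieldType) (iota : {rmorphism K -> E})
    (G : orderedZmodType) (nu : valuation K G) (nubar : valuation E G)
    (ext : extends iota nu nubar) (a : E) : Prop :=
  defectless (extends_adjoin [set a]%classic ext).

Section Pairs.
Variables (K : fieldType) (L : closedFieldType) (iota : {rmorphism K -> L}).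
Variables (G : orderedZmodType) (nubar : valuation L G).

(* [K(z) : K] *)
Definition elt_degree (z : L) : nat := degree (to_adjoin iota [set z]%classic).

(* The coefficients of p(X + a) are those of the expansion of p in X - a. *)
Definition gauss_poly_val (a : L) (g : G) (p : {poly L}) : option G :=
  let q := p \Po ('X + a%:P) in
  \big[@vmin G/None]_(i < size q) vadd (nubar q`_i) (Some (g *+ i)).

Definition gauss_val (a : L) (g : G) (r : ratfun L) : option G :=
  vsub (gauss_poly_val a g (ratfun_num r)) (gauss_poly_val a g (ratfun_den r)).

Definition pair_of_definition (omegabar : valuation (ratfun L) G)
    (a : L) (g : G) : Prop :=
  g \in in_value_group omegabar /\ omegabar =1 gauss_val a g.

Definition minimal_pair_of_definition (omegabar : valuation (ratfun L) G)
    (a : L) (g : G) : Prop :=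
  pair_of_definition omegabar a g /\
  forall b : L, vle (Some g) (nubar (a - b)) ->
    (elt_degree a <= elt_degree b)%N.

(* M(a) *)
Definition approx_values (a : L) : set (option G) :=
  [set nubar (a - z) | z in [set z | (elt_degree z < elt_degree a)%N]]%classic.

(* d = max M(a) *)
Definition is_delta (a : L) (d : option G) : Prop :=
  approx_values a d /\ forall m, approx_values a m -> vle m d.

Definition realizes_delta (a z : L) : Prop :=
  (elt_degree z < elt_degree a)%N /\ is_delta a (nubar (a - z)).

Definition distinguished_pair (a z : L) : Prop :=
  realizes_delta a z /\
  forall z', realizes_delta a z' -> (elt_degree z <= elt_degree z')%N.

Definition complete_distinguished_chain (a : L) (n : nat)
    (c : 'I_n.+1 -> L) : Prop :=
  [/\ c ord0 = a,
      forall i : 'I_n,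
        distinguished_pair (c (widen_ord (leqnSn n) i)) (c (lift ord0 i)) &
      exists k : K, c ord_max = iota k].

End Pairs.

(* Main.v *)
Require Import Defs.
From mathcomp Require Import all_boot all_order all_algebra.
From mathcomp Require Import boolp classical_sets cardinality.

Set Implicit Arguments.
Unset Strict Implicit.
Unset Printing Implicit Defensive.

Import GRing.Theory.
Local Open Scope ring_scope.

(** Walk along the chain as long as [nubar (a_i - a_(i+1)) >= gamma]: such a
    step keeps the pair a pair of definition, because [nubar_(a,gamma)] only
    depends on the ball of radius [gamma] around [a].  If the walk stops at
    [i < n], then [gamma > delta(a_i, K)], which is minimality of [(a_i, gamma)];
    otherwise it reaches [a_n], which lies in [K] and has degree 1. *)

Section OptionValues.
Variable G : orderedZmodType.
Implicit Types s t u : option G.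

Lemma vle_refl s : vle s s.
Proof. by case: s => //= x; apply: gle_refl. Qed.

Lemma vle_anti : antisymmetric (@vle G).
Proof. by move=> [x|] [y|] //= /gle_anti ->. Qed.

Lemma vle_total : total (@vle G).
Proof. by move=> [x|] [y|] //=; apply: gle_total. Qed.

Lemma vle_minE s t u : vle s (vmin t u) = vle s t && vle s u.
Proof.
rewrite /vmin; case: ifP => tu.
  by apply/idP/andP => [st|[]//]; split=> //; apply: vle_trans st tu.
apply/idP/andP => [su|[]//]; split=> //; apply: vle_trans su _.
by have := vle_total t u; rewrite tu.
Qed.

Lemma vadd_mono s t s' t' : vle s t -> vle s' t' -> vle (vadd s s') (vadd t t').
Proof.
case: s t s' t' => [x|] [y|] [x'|] [y'|] //= xy xy'.
apply: gle_trans (gle_addr x' _ _ xy) _.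
by rewrite ![y + _]addrC; apply: gle_addr.
Qed.

Lemma vaddA : associative (@vadd G).
Proof. by move=> [x|] [y|] [z|] //=; rewrite /vadd addrA. Qed.

Lemma vaddC : commutative (@vadd G).
Proof. by move=> [x|] [y|] //=; rewrite /vadd addrC. Qed.

Lemma vadd0 s : vadd s (Some 0) = s.
Proof. by case: s => //= x; rewrite /vadd addr0. Qed.

(** [None] is the top value, so the seed of the minimum imposes no bound. *)
Lemma vle_bigmin (I : finType) (f : I -> option G) s :
  vle s (\big[@vmin G/None]_i f i) <-> forall i, vle s (f i).
Proof.
have sNone : vle s None by case: s.
split=> [h i|h]; last by elim/big_ind: _ => // x y sx sy; rewrite vle_minE sx.
move: h; have := mem_index_enum i; elim: (index_enum I) => // j r IH.
rewrite inE big_cons vle_minE => /orP[/eqP <-|ir] /andP[] //.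
by move=> _; apply: IH.
Qed.

End OptionValues.

Section GaussValuation.
Variables (L : closedFieldType) (G : orderedZmodType) (v : valuation L G).
Variable g : G.

(** All indices are allowed, not only those below [size q]: coefficients past the size are 0, of
    value [None], and sums and shifts then need no size bookkeeping. *)
Definition gauss_ge (m : option G) (q : {poly L}) : Prop :=
  forall i, vle m (vadd (v q`_i) (Some (g *+ i))).

Lemma gauss_geP a m p :
  vle m (gauss_poly_val v a g p) <-> gauss_ge m (p \Po ('X + a%:P)).
Proof.
rewrite /gauss_poly_val vle_bigmin; split=> [h i|h i]; last exact: h.
have [lt_i|le_i] := ltnP i (size (p \Po ('X + a%:P))).
  exact: h (Ordinal lt_i).
by rewrite nth_default // vval0; case: m h.
Qed.

Lemma gauss_geD m p q : gauss_ge m p -> gauss_ge m q -> gauss_ge m (p + q).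
Proof.
move=> hp hq i; rewrite coefD.
apply: vle_trans (vadd_mono (vvalD _ _ _) (vle_refl _)).
by rewrite /vmin; case: ifP.
Qed.

(** Horner induction: [q * 'X + c] turns into [q(X+d) * X + q(X+d) * d + c], and multiplying by ['X]
    or by [d] raises a bound by at least [g]. The bound [m] varies in the induction. *)
Lemma gauss_ge_shift m d q : vle (Some g) (v d) ->
  gauss_ge m q -> gauss_ge m (q \Po ('X + d%:P)).
Proof.
move=> gd; elim/poly_ind: q m => [|q c IH] m hq; first by rewrite comp_poly0.
rewrite comp_polyD comp_polyM comp_polyX comp_polyC mulrDr.
(* Coefficient [i.+1] of [q * 'X + c] is coefficient [i] of [q], so its weight drops by [g]. *)
set m' := vadd m (Some (- g)).
have m'K : m = vadd m' (Some g).
  by rewrite -vaddA [vadd (Some _) _]/vadd addNr vadd0.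
have {IH} hq' : gauss_ge m' (q \Po ('X + d%:P)).
  apply: IH => i; have := hq i.+1.
  rewrite coefD coefMX coefC /= addr0 => /vadd_mono /(_ (vle_refl (Some (- g)))).
  by rewrite -vaddA [vadd (Some _) (Some _)]/vadd mulrS addrAC subrr add0r.
apply: gauss_geD; first apply: gauss_geD.
- move=> [|i]; rewrite coefMX /=; first by rewrite vval0; case: (m).
  rewrite m'K mulrSr -[Some (g *+ i + g)]/(vadd (Some (g *+ i)) (Some g)) vaddA.
  by apply: vadd_mono (vle_refl _).
(* Here [vle (Some g) (v d)] makes up for the [g] lost in [m']. *)
- move=> i; rewrite coefMC vvalM -vaddA [vadd (v d) _]vaddC vaddA m'K.
  exact: vadd_mono.
move=> [|i]; rewrite coefC /=; last by rewrite vval0; case: (m).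
by have := hq 0%N; rewrite coefD coefMX coefC /= add0r.
Qed.

(** The expansion at [b] is the expansion at [a] shifted by [b - a], whose value is at least [g]. *)
Lemma gauss_poly_val_le a b p : vle (Some g) (v (a - b)) ->
  vle (gauss_poly_val v a g p) (gauss_poly_val v b g p).
Proof.
move=> gab; apply/gauss_geP.
have -> : p \Po ('X + b%:P) = (p \Po ('X + a%:P)) \Po ('X + (b - a)%:P).
  rewrite -comp_polyA comp_polyD comp_polyX comp_polyC polyCB.
  by rewrite -addrA subrK.
apply: gauss_ge_shift; first by rewrite -vvalN opprB.
by apply/gauss_geP; apply: vle_refl.
Qed.

(** The ball condition is symmetric in [a] and [b], so the previous inequality holds both ways, for
    numerator and denominator alike. *)
Lemma pair_of_definition_ball (w : valuation (ratfun L) G) a b :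
  vle (Some g) (v (a - b)) ->
  pair_of_definition v w a g -> pair_of_definition v w b g.
Proof.
move=> gab [gw wE]; split=> // r; rewrite wE /gauss_val.
have E p : gauss_poly_val v a g p = gauss_poly_val v b g p.
  apply: vle_anti; rewrite !gauss_poly_val_le //.
  by rewrite -vvalN opprB.
by rewrite !E.
Qed.

End GaussValuation.

Section Degree.
Variables (F E : fieldType) (f : {rmorphism F -> E}).

(** For [p] of least size among the nonzero polynomials killing [x], evaluation at [x] is a
    bijection from polynomials of smaller size: injective by minimality, surjective by division by
    [p]. *)
Lemma simple_ext_has_degree (x : E) : algebraicOver f x ->
  (forall y, exists q : {poly F}, y = (map_poly f q).[x]) ->
  exists n, has_degree f n.
Proof.
move=> [p0 p0_neq0 p0x] gen.
pose P k := `[< exists p : {poly F},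
  [/\ p != 0, root (map_poly f p) x & size p = k] >].
have exP : exists k, P k by exists (size p0); apply/asboolP; exists p0.
case: (ex_minnP exP) => k /asboolP[p [p_neq0 px szp]] kmin {p0 p0_neq0 p0x exP}.
(* Row vectors of length [(size p).-1] encode the polynomials of degree below that of [p]. *)
pose psi (r : 'rV[F]_(size p).-1) : ext_space f := (map_poly f (rVpoly r)).[x].
have psi_lin : linear psi.
  move=> c r s; rewrite /psi linearP /= rmorphD /= hornerD.
  by rewrite map_polyZ hornerZ.
have psi_inj : injective psi.
  move=> r s rs; apply/eqP; rewrite -subr_eq0; apply/eqP.
  apply: (can_inj rVpolyK); rewrite linear0.
  apply/eqP; apply/negPn/negP => rs_neq0.
  have : P (size (rVpoly (r - s))).
    apply/asboolP; exists (rVpoly (r - s)); split=> //.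
    rewrite linearB /= rmorphB /= rootE hornerD hornerN.
    by rewrite subr_eq0; apply/eqP.
  move/kmin; rewrite -szp => le_sz; have := leq_trans le_sz (size_poly _ _).
  by rewrite -ltnS prednK ?size_poly_gt0 // ltnn.
have psi_surj y : exists r, psi r = y.
  have [q ->] := gen y; exists (poly_rV (q %% p)).
  rewrite /psi poly_rV_K; last first.
    by rewrite -ltnS prednK ?size_poly_gt0 // ltn_modp.
  rewrite [in RHS](divp_eq q p) rmorphD rmorphM /= hornerD hornerM.
  by rewrite (rootP px) mulr0 add0r.
pose phi y := xget 0 [set r | psi r = y]%classic.
have phiK : cancel phi psi.
  by move=> y; exact: (@xgetPex _ 0 [set r | psi r = y]%classic (psi_surj y)).
have psiK : cancel psi phi by move=> r; apply: psi_inj; rewrite phiK.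
exists (size p).-1; exists phi; last by exists psi.
by move=> c r s; apply: psi_inj; rewrite psi_lin !phiK.
Qed.

(** A known degree rules out the default 0 of [degree], and dimension 0 would force 1 = 0 in [E]. *)
Lemma degree_gt0 n : has_degree f n -> (0 < degree f)%N.
Proof.
move=> fn; have : has_degree f (degree f).
  exact: (@xgetPex _ 0%N [set m | has_degree f m]%classic (ex_intro _ n fn)).
case: (degree f) => // -[phi _ /bij_inj phi_inj].
have : (1 : E) = 0 by apply: phi_inj; apply/rowP => -[].
by move/eqP; rewrite oner_eq0.
Qed.

(** The default 0 satisfies the bound. Otherwise every row of the identity matrix is a multiple of
    [phi 1], so its rank [m] is at most 1. *)
Lemma degree_le1 : (forall y, exists c, y = f c) -> (degree f <= 1)%N.
Proof.
move=> f_surj; rewrite /degree; case: xgetP => // m _ [phi phi_lin phi_bij].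
case: phi_bij => psi phiK psiK.
have phi0 : phi 0 = 0.
  by have := phi_lin (-1) 0 0; rewrite !scaleN1r !addNr.
rewrite -(mxrank1 F m); apply: leq_trans (rank_leq_row (phi 1)).
apply: mxrankS; apply/row_subP => i.
have [c yc] := f_surj (psi (row i 1%:M)).
rewrite -[row i _]psiK (_ : psi _ = c *: (1 : ext_space f) + 0); last first.
  by rewrite yc addr0; exact: esym (mulr1 _).
by rewrite phi_lin phi0 addr0 scalemx_sub.
Qed.

End Degree.

Section EltDegree.
Variables (K : fieldType) (L : closedFieldType) (iota : {rmorphism K -> L}).

(** The image of [iota] is already a subfield containing [iota k]. *)
Lemma elt_degree_base (k : K) : (elt_degree iota (iota k) <= 1)%N.
Proof.
apply: degree_le1 => -[y y_adj].
pose P := [pred z | `[< exists c, z = iota c >]].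
suff /asboolP[c yc] : y \in P by exists c; apply: val_inj.
have /asboolP/(_ P) := y_adj; apply=> [||_ ->].
- split=> [|_ _ /asboolP[c ->] /asboolP[d ->]|_ _ /asboolP[c ->] /asboolP[d ->]].
  + by apply/asboolP; exists 1; rewrite rmorph1.
  + by apply/asboolP; exists (c - d); rewrite rmorphB.
  by apply/asboolP; exists (c / d); rewrite fmorph_div.
- by move=> c; apply/asboolP; exists c.
by apply/asboolP; exists k.
Qed.

(** By algebraicity the ring K[z] is closed under inverses, hence is a subfield containing K(z). *)
Lemma adjoin_algebraic_poly (z y : L) : (forall u, algebraicOver iota u) ->
  y \in in_adjoin iota [set z]%classic ->
  exists q : {poly K}, y = (map_poly iota q).[z].
Proof.
move=> alg y_adj; pose P := [pred u | `[< exists q, u = (map_poly iota q).[z] >]].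
(* A relation [p(u) * u + c = 0] with [c != 0] gives [u^-1 = - c^-1 * p(u)]; if [c = 0], cancel [u]
   and recurse on [p]. *)
have inv q : exists r, (map_poly iota q).[z]^-1 = (map_poly iota r).[z].
  set u := (map_poly iota q).[z].
  have [->|u_neq0] := eqVneq u 0; first by exists 0; rewrite invr0 rmorph0 horner0.
  have [p p_neq0] := alg u.
  elim/poly_ind: p p_neq0 => [|p c IH]; first by rewrite eqxx.
  rewrite rmorphD rmorphM /= map_polyX map_polyC /= rootE hornerMXaddC.
  have [->|c_neq0 _ /eqP pu] := eqVneq c 0.
    rewrite !rmorph0 !addr0 !mulf_eq0 polyX_eq0 (negPf u_neq0) !orbF.
    exact: IH.
  exists (- c^-1 *: (p \Po q)); rewrite map_polyZ hornerZ map_comp_poly horner_comp.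
  apply: (mulIf u_neq0); rewrite mulVf // -mulrA (_ : _ * u = - iota c).
    by rewrite rmorphN fmorphV mulrNN mulVf ?fmorph_eq0.
  by apply/eqP; rewrite -addr_eq0 pu.
suff /asboolP : y \in P by [].
have /asboolP/(_ P) := y_adj; apply=> [||_ ->].
- split=> [|_ _ /asboolP[c ->] /asboolP[d ->]|_ _ /asboolP[c ->] /asboolP[d ->]].
  + by apply/asboolP; exists 1; rewrite rmorph1 hornerC.
  + by apply/asboolP; exists (c - d); rewrite rmorphB hornerD hornerN.
  have [r ->] := inv d.
  by apply/asboolP; exists (c * r); rewrite rmorphM hornerM.
- by move=> c; apply/asboolP; exists c%:P; rewrite map_polyC hornerC.
by apply/asboolP; exists 'X; rewrite map_polyX hornerX.
Qed.

(** Algebraicity makes K(z) finite over K, so [elt_degree] is a true degree and not the default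
    0. *)
Lemma elt_degree_gt0 (z : L) : (forall u, algebraicOver iota u) ->
  (0 < elt_degree iota z)%N.
Proof.
move=> alg; set A := [set z]%classic.
have zA : z \in in_adjoin iota A by apply/asboolP => P _ _; apply.
(* Evaluation inside K(z) agrees with evaluation in [L], which carries over both the annihilating
   polynomial and the generation by [z]. *)
have evalA q : val (map_poly (to_adjoin iota A) q).[Adjoin zA] =
    (map_poly iota q).[z].
  by rewrite -horner_map -map_poly_comp.
have [||n] := @simple_ext_has_degree _ _ (to_adjoin iota A) (Adjoin zA).
- have [p p_neq0 pz] := alg z; exists p => //.
  by apply/rootP; apply: val_inj; rewrite evalA (rootP pz).
- move=> y; have [q yq] := adjoin_algebraic_poly alg (valP y).
  by exists q; apply: val_inj; rewrite evalA.
exact: degree_gt0.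
Qed.

End EltDegree.

Theorem theorem3p9
    (G : orderedZmodType) (K : fieldType) (L : closedFieldType)
    (iota : {rmorphism K -> L})
    (iota_alg : forall z : L, algebraicOver iota z)
    (nu : valuation K G) (omega : valuation (ratfun K) G)
    (nubar : valuation L G) (omegabar : valuation (ratfun L) G)
    (nu_omega : extends (@ratfun_const K) nu omega)
    (nu_nubar : extends iota nu nubar)
    (omega_omegabar : extends (ratfun_map iota) omega omegabar)
    (nubar_omegabar : extends (@ratfun_const L) nubar omegabar)
    (omega_vt : valuation_transcendental nu_omega)
    (a : L) (gamma : G)
    (a_gamma : pair_of_definition nubar omegabar a gamma)
    (nu_henselian : henselian iota nu)
    (Ka_defectless : elt_defectless nu_nubar a)
    (n : nat) (c : 'I_n.+1 -> L)
    (c_chain : complete_distinguished_chain iota nubar a c) :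
  exists i : 'I_n.+1, minimal_pair_of_definition iota nubar omegabar (c i) gamma.
Proof.
case: c_chain => c0 c_dist [k ck].
(* Induction on the number [j] of links left before the end of the chain. *)
have walk j : forall i : 'I_n.+1, (i + j = n)%N ->
    pair_of_definition nubar omegabar (c i) gamma ->
    exists i, minimal_pair_of_definition iota nubar omegabar (c i) gamma.
  elim: j => [|j IH] i ij ci.
    exists i; split=> // b _; apply: leq_trans (elt_degree_gt0 b iota_alg).
    have -> : i = ord_max by apply: val_inj; rewrite /= -[RHS]ij addn0.
    by rewrite ck elt_degree_base.
  have lt_in : (i < n)%N by rewrite -[ltnRHS]ij addnS ltnS leq_addr.
  have [[_ [_ delta_max]] _] := c_dist (Ordinal lt_in).
  have ei : widen_ord (leqnSn n) (Ordinal lt_in) = i by apply: val_inj.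
  rewrite ei in delta_max.
  set i' := lift ord0 _ in delta_max.
  have [close|far] := boolP (vle (Some gamma) (nubar (c i - c i'))).
    apply: (IH i'); last exact: pair_of_definition_ball close ci.
    by rewrite lift0 /= addSn -addnS.
  (* A [b] of smaller degree in the ball would put a value at least [gamma] in M([c i]), whose
     maximum is [nubar (c i - c i')], against [far]. *)
  exists i; split=> // b ib; rewrite leqNgt; apply: contra far => lt_b.
  by apply: vle_trans ib _; apply: delta_max; exists b.
by apply: (walk n ord0) => //; rewrite c0.
Qed.
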